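(* Let $m,n,s,k$ be integers with $m+s\ge n\ge s\ge 0$ and $k\le n$. Let $A\in\mathbb{R}^{m\times n}$, $B\in\mathbb{R}^{s\times n}$, $b\in\mathbb{R}^m$, $d\in\mathbb{R}^s$ satisfy $\mathrm{rank}(B)=s$ and $\mathrm{null}(A)\cap\mathrm{null}(B)=\{0\}$, let $L\in\mathbb{R}^{n\times k}$, and let $\alpha_A,\alpha_B,\alpha_b,\alpha_d>0$. Let $x=x(A,B,b,d)$ be the unique solution of $\min_{Bx=d}\|b-Ax\|_2$ and $r=b-Ax$. Let $A=U\Sigma X^{-1}$, $B=V\Lambda X^{-1}$ be a generalized singular value decomposition of the pair $A,B$ in the form described in the context, and partition $X=[X_1,X_2]$ with $X_1\in\mathbb{R}^{n\times(n-s)}$, $X_2\in\mathbb{R}^{n\times s}$, and $U=[U_1,U_2]$ with $U_1\in\mathbb{R}^{m\times(n-s)}$, $U_2\in\mathbb{R}^{m\times(m-n+s)}$. Then the partial condition number with respect to $L$ (defined in the context) satisfies $\kappa_{LSE}(A,B,b,d)=\|C\|_2^{1/2}$ with $$\begin{aligned}C={}&\left(\frac{\|r\|_2^2}{\alpha_A^2}+\frac{1}{\alpha_B^2}\left\|r^TU_2\begin{bmatrix}S_AS_B^{-1}&0\\0&0\end{bmatrix}\right\|_2^2\right)L^T(X_1X_1^T)^2L+L^T(X_1S_1X_1^T+X_2S_2X_2^T)L\\&+\frac1{\alpha_B^2}L^TX_1X_1^Txr^TU_2\begin{bmatrix}S_AS_B^{-2}&0\\0&0\end{bmatrix}X_2^TL+\frac1{\alpha_B^2}L^TX_2\begin{bmatrix}S_AS_B^{-2}&0\\0&0\end{bmatrix}^TU_2^Trx^TX_1X_1^TL,\end{aligned}$$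 where the block matrices displayed (before transposition) have size $(m-n+s)\times s$, and $$S_1=\left(\frac{\|x\|_2^2}{\alpha_A^2}+\frac1{\alpha_b^2}\right)I_{n-s},\qquad S_2=\left(\frac{\|x\|_2^2}{\alpha_B^2}+\frac1{\alpha_d^2}\right)\Lambda_1^{-2}.$$
   Context: For a matrix $C$, $C^\dagger$ is the Moore-Penrose inverse, $\|C\|_2$ the spectral norm and $\|C\|_F$ the Frobenius norm. $P=I_n-B^\dagger B$ and $B_A^\dagger=(I_n-(AP)^\dagger A)B^\dagger$. Generalized singular value decomposition: $U\in\mathbb{R}^{m\times m}$ and $V\in\mathbb{R}^{s\times s}$ are orthogonal, $X\in\mathbb{R}^{n\times n}$ is nonsingular, $A=U\Sigma X^{-1}$, $B=V\Lambda X^{-1}$, where with $t=\mathrm{rank}(A)+s-n$, $$\Sigma=\begin{bmatrix}I_{n-s}&0&0\\0&S_A&0\\0&0&0\end{bmatrix}\in\mathbb{R}^{m\times n},\qquad \Lambda=[\,0\ \ \Lambda_1\,]\in\mathbb{R}^{s\times n},\qquad \Lambda_1=\begin{bmatrix}S_B&0\\0&I_{s-t}\end{bmatrix}\in\mathbb{R}^{s\times s},$$ $S_A=\mathrm{diag}(\alpha_1,\dots,\alpha_t)$, $S_B=\mathrm{diag}(\beta_1,\dots,\beta_t)$, $\alpha_i,\beta_i>0$, $\alpha_i^2+\beta_i^2=1$. (Such a decomposition exists under the stated rank conditions.) Under the rank conditions $\mathrm{rank}(B)=s$, $\mathrm{null}(A)\cap\mathrm{null}(B)=\{0\}$, the problem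 $\min_{Bx=d}\|b-Ax\|_2$ has the unique solution $x(A,B,b,d)=(AP)^\dagger b+B_A^\dagger d$. Define $g(A,B,b,d)=L^Tx(A,B,b,d)\in\mathbb{R}^k$; $g$ is continuously Fréchet differentiable in a neighborhood of $(A,B,b,d)$ in $\mathbb{R}^{m\times n}\times\mathbb{R}^{s\times n}\times\mathbb{R}^m\times\mathbb{R}^s$, and $g'(A,B,b,d)$ denotes its Fréchet derivative (a linear map) there. The weighted Frobenius norm is $$\|(\alpha_A\Delta A,\alpha_B\Delta B,\alpha_b\Delta b,\alpha_d\Delta d)\|_F=\sqrt{\alpha_A^2\|\Delta A\|_F^2+\alpha_B^2\|\Delta B\|_F^2+\alpha_b^2\|\Delta b\|_2^2+\alpha_d^2\|\Delta d\|_2^2}.$$ The partial condition number with respect to $L$ is $$\kappa_{LSE}(A,B,b,d)=\max_{(\Delta A,\Delta B,\Delta b,\Delta d)\ne0}\frac{\|g'(A,B,b,d)(\Delta A,\Delta B,\Delta b,\Delta d)\|_2}{\|(\alpha_A\Delta A,\alpha_B\Delta B,\alpha_b\Delta b,\alpha_d\Delta d)\|_F},$$ the maximum being over all $\Delta A\in\mathbb{R}^{m\times n}$, $\Delta B\in\mathbb{R}^{s\times n}$, $\Delta b\in\mathbb{R}^m$, $\Delta d\in\mathbb{R}^s$ not all zero. *)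

(* Defs.v *)
From HB Require Import structures.
From mathcomp Require Import all_boot all_order all_algebra.
From mathcomp Require Import all_classical all_reals all_analysis.
Set Implicit Arguments.
Unset Strict Implicit.
Unset Printing Implicit Defensive.
Import Order.TTheory GRing.Theory Num.Theory.
Import numFieldNormedType.Exports.
Local Open Scope classical_set_scope.
Local Open Scope ring_scope.

(* The library norm of a matrix is the largest absolute value of an entry, so
   the Frobenius and spectral norms are defined here. On a row or a column
   [normF] is the Euclidean norm. *)
Definition normF (R : realType) (m n : nat) (M : 'M[R]_(m, n)) : R :=
  Num.sqrt (\sum_i \sum_j M i j ^+ 2).

Definition norm2 (R : realType) (m n : nat) (M : 'M[R]_(m, n)) : R :=
  sup [set normF (M *m v) | v in [set v : 'cV[R]_n | normF v <= 1]].

Definition is_mpinv (R : realType) (m n : nat) (M : 'M[R]_(m, n))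
    (G : 'M[R]_(n, m)) : Prop :=
  [/\ M *m G *m M = M, G *m M *m G = G,
      (M *m G)^T = M *m G & (G *m M)^T = G *m M].

Definition mpinv (R : realType) (m n : nat) (M : 'M[R]_(m, n)) : 'M[R]_(n, m) :=
  xget 0 [set G | is_mpinv M G].

Lemma trmx_mul_eq0 (R : realType) (m n : nat) (M : 'M[R]_(m, n)) :
  M^T *m M = 0 -> M = 0.
Proof.
move=> M0; apply/matrixP => i j; rewrite mxE.
have /eqP := congr1 (fun N : 'M[R]_n => N j j) M0; rewrite !mxE.
under eq_bigr do rewrite mxE -expr2.
rewrite psumr_eq0 => [|k _]; last exact: sqr_ge0.
by move=> /allP /(_ i); rewrite mem_index_enum sqrf_eq0 => /(_ isT) /eqP.
Qed.

Lemma gram_unitmx (R : realType) (m n : nat) (M : 'M[R]_(m, n)) :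
  row_full M -> M^T *m M \in unitmx.
Proof.
move=> Mf; rewrite -row_free_unit; apply/row_freeP.
exists (invmx (M^T *m M)); rewrite mulmxV // -row_free_unit -kermx_eq0.
apply/eqP; set K := kermx _.
have MK0 : M *m K^T = 0.
  apply: trmx_mul_eq0; rewrite trmx_mul trmxK -mulmxA (mulmxA M^T).
  by rewrite mulmxA mulmx_ker mul0mx.
have [N NM] := row_fullP Mf.
by apply: trmx_inj; rewrite trmx0 -[K^T]mul1mx -NM -mulmxA MK0 mulmx0.
Qed.

Lemma is_mpinv_mul (R : realType) (m n r : nat) (C : 'M[R]_(m, r))
    (W : 'M[R]_(r, n)) : row_full C -> row_free W ->
  is_mpinv (C *m W) (W^T *m invmx (W *m W^T) *m (invmx (C^T *m C) *m C^T)).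
Proof.
move=> fC fW.
have uC : C^T *m C \in unitmx by exact: gram_unitmx.
have uW : W *m W^T \in unitmx.
  by rewrite -{1}(trmxK W); apply: gram_unitmx; rewrite /row_full mxrank_tr.
set iC := invmx (C^T *m C); set iW := invmx (W *m W^T).
have CC : iC *m C^T *m C = 1%:M by rewrite -mulmxA mulVmx.
have WW : W *m (W^T *m iW) = 1%:M by rewrite mulmxA mulmxV.
pose G := W^T *m iW *m (iC *m C^T); rewrite -/G.
have MG : C *m W *m G = C *m (iC *m C^T).
  by rewrite /G mulmxA -(mulmxA C) WW mulmx1.
have GM : G *m (C *m W) = W^T *m iW *m W.
  by rewrite /G mulmxA -(mulmxA (W^T *m iW) _ C) CC mulmx1.
have iCT : iC^T = iC by rewrite /iC trmx_inv trmx_mul trmxK.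
have iWT : iW^T = iW by rewrite /iW trmx_inv trmx_mul trmxK.
split.
- by rewrite MG -(mulmxA C) (mulmxA _ C W) CC mul1mx.
- by rewrite GM /G mulmxA -(mulmxA (W^T *m iW)) WW mulmx1.
- by rewrite MG !trmx_mul trmxK iCT mulmxA.
- by rewrite GM !trmx_mul trmxK iWT mulmxA.
Qed.

Lemma mpinvP (R : realType) (m n : nat) (M : 'M[R]_(m, n)) :
  is_mpinv M (mpinv M).
Proof.
rewrite /mpinv; apply: (@xgetPex _ 0 [set G | is_mpinv M G]).
have := is_mpinv_mul (col_base_full M) (row_base_free M).
by rewrite mulmx_base => MP; eexists; exact: MP.
Qed.

Lemma is_mpinv_inj (R : realType) (m n : nat) (M : 'M[R]_(m, n))
    (G H : 'M[R]_(n, m)) : is_mpinv M G -> is_mpinv M H -> G = H.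
Proof.
move=> [MGM GMG MGT GMT] [MHM HMH MHT HMT].
have MGH : M *m G = M *m H.
  rewrite -MGT -[in LHS]MHM -(mulmxA (M *m H)) trmx_mul MGT MHT.
  by rewrite (mulmxA (M *m G)) MGM.
have GHM : G *m M = H *m M.
  rewrite -GMT -[in LHS]MHM -(mulmxA M H) mulmxA trmx_mul HMT GMT.
  by rewrite -(mulmxA H) (mulmxA M G) MGM.
by rewrite -GMG GHM -mulmxA MGH mulmxA HMH.
Qed.

Definition is_lse_solution (R : realType) (m n s : nat) (A : 'M[R]_(m, n))
    (B : 'M[R]_(s, n)) (b : 'cV[R]_m) (d : 'cV[R]_s) (x : 'cV[R]_n) : Prop :=
  B *m x = d /\
  forall y : 'cV[R]_n, B *m y = d -> normF (b - A *m x) <= normF (b - A *m y).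

(* [lse_proj B] is P, [wpinv A B] is the weighted pseudoinverse B_A^+, and
   [lse_sol] is the closed formula (AP)^+ b + B_A^+ d. It is total, hence also
   defined when the rank conditions on (A, B) fail. *)
Definition lse_proj (R : realType) (n s : nat) (B : 'M[R]_(s, n)) : 'M[R]_n :=
  1%:M - mpinv B *m B.

Definition wpinv (R : realType) (m n s : nat) (A : 'M[R]_(m, n))
    (B : 'M[R]_(s, n)) : 'M[R]_(n, s) :=
  (1%:M - mpinv (A *m lse_proj B) *m A) *m mpinv B.

Definition lse_sol (R : realType) (m n s : nat) (A : 'M[R]_(m, n))
    (B : 'M[R]_(s, n)) (b : 'cV[R]_m) (d : 'cV[R]_s) : 'cV[R]_n :=
  mpinv (A *m lse_proj B) *m b + wpinv A B *m d.

(* The data space, with tuples (A, B, b, d). *)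
Definition lse_data (R : realType) (m n s : nat) : normedModType R :=
  ('M[R]_(m, n) * 'M[R]_(s, n) * 'cV[R]_m * 'cV[R]_s)%type.

Definition lse_map (R : realType) (m n s k : nat) (L : 'M[R]_(n, k))
    (D : lse_data R m n s) : 'cV[R]_k :=
  let: (A, B, b, d) := D in L^T *m lse_sol A B b d.

Definition wnormF (R : realType) (m n s : nat) (aA aB ab ad : R)
    (D : lse_data R m n s) : R :=
  let: (dA, dB, db, dd) := D in
  Num.sqrt (aA ^+ 2 * normF dA ^+ 2 + aB ^+ 2 * normF dB ^+ 2
            + ab ^+ 2 * normF db ^+ 2 + ad ^+ 2 * normF dd ^+ 2).

Definition cond_ratios (R : realType) (m n s k : nat) (L : 'M[R]_(n, k))
    (aA aB ab ad : R) (D : lse_data R m n s) : set R :=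
  [set normF ('d (lse_map L) D E) / wnormF aA aB ab ad E
    | E in [set E : lse_data R m n s | E != 0]].

(* The supremum is a maximum as soon as there is a nonzero perturbation; when
   the data space is trivial (m = n = s = 0) the value is sup set0 = 0. *)
Definition kappaLSE (R : realType) (m n s k : nat) (L : 'M[R]_(n, k))
    (aA aB ab ad : R) (D : lse_data R m n s) : R :=
  sup (cond_ratios L aA aB ab ad D).

Lemma dim_rows (m n s : nat) :
  (n <= m + s)%N -> (s <= n)%N -> (n - s + (m + s - n) = m)%N.
Proof. by move=> nms sn; rewrite addnC addnBA // subnK // addnK. Qed.

(* [padmx M] is the p x q block matrix [M 0; 0 0], for t <= p and t <= q. *)
Definition padmx (R : realType) (p q t : nat) (M : 'M[R]_t) : 'M[R]_(p, q) :=
  pid_mx t *m M *m pid_mx t.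

(* Below, p stands for n - s and q for m - n + s. *)
Definition gsvd_Sigma (R : realType) (m n s p q t : nat)
    (em : (p + q)%N = m) (en : (p + s)%N = n) (SA : 'M[R]_t) : 'M[R]_(m, n) :=
  castmx (em, en) (block_mx 1%:M 0 0 (padmx q s SA)).

(* [copid_mx t] has the diagonal blocks 0 (of size t) and I_(s - t). *)
Definition gsvd_Lambda1 (R : realType) (s t : nat) (SB : 'M[R]_t) : 'M[R]_s :=
  padmx s s SB + copid_mx t.

Definition gsvd_Lambda (R : realType) (n s p t : nat)
    (en : (p + s)%N = n) (SB : 'M[R]_t) : 'M[R]_(s, n) :=
  castmx (erefl s, en) (row_mx 0 (gsvd_Lambda1 s SB)).

Definition is_gsvd (R : realType) (m n s p q t : nat)
    (em : (p + q)%N = m) (en : (p + s)%N = n)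
    (A : 'M[R]_(m, n)) (B : 'M[R]_(s, n))
    (U : 'M[R]_m) (V : 'M[R]_s) (X : 'M[R]_n) (al be : 'rV[R]_t) : Prop :=
  [/\ U^T *m U = 1%:M, V^T *m V = 1%:M & X \in unitmx] /\
  [/\ A = U *m gsvd_Sigma em en (diag_mx al) *m invmx X,
      B = V *m gsvd_Lambda en (diag_mx be) *m invmx X
    & forall i, [/\ 0 < al 0 i, 0 < be 0 i & al 0 i ^+ 2 + be 0 i ^+ 2 = 1]].

(* The blocks of M = [M_1, M_2], with p and q columns respectively. *)
Definition lcols (R : realType) (r n p q : nat) (e : (p + q)%N = n)
    (M : 'M[R]_(r, n)) : 'M[R]_(r, p) :=
  lsubmx (castmx (erefl r, esym e) M).

Definition rcols (R : realType) (r n p q : nat) (e : (p + q)%N = n)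
    (M : 'M[R]_(r, n)) : 'M[R]_(r, q) :=
  rsubmx (castmx (erefl r, esym e) M).

(* Main.v *)
(** For data near (A, B, b, d) the solution x satisfies, with its residual r and
    a multiplier l, the linear system r + A x = b, B x = d, A^T r = B^T l.
    Subtracting the unperturbed system shows that the increment of x is
      Q A^T (db - dA x) + W (dd - dB x) + Q (dA^T r - dB^T l)
    up to terms of second order, where Q = (AP)^+ ((AP)^+)^T and W = B_A^+; this
    is the derivative of x. For the weighted inner product on the data space the
    derivative J of L^T x has an explicit adjoint J*, and J J* is a k x k matrix
    M. Compactness of the unit ball of R^k then shows that the operator norm of J
    is attained and equals the square root of the spectral norm of M. In terms of
    the GSVD, Q = X1 X1^T, W = X2 Lambda1^-1 V^T and l = V N1^T U2^T r with
    N1 = [S_A S_B^-1, 0; 0, 0], which turns M into the matrix C. *)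

Require Import Defs.
From HB Require Import structures.
From mathcomp Require Import all_boot all_order all_algebra.
From mathcomp Require Import all_classical all_reals all_analysis.
From mathcomp Require Import ring lra.
Import Order.TTheory GRing.Theory Num.Theory.
Import numFieldNormedType.Exports.
Local Open Scope classical_set_scope.
Local Open Scope ring_scope.

Set Implicit Arguments.
Unset Strict Implicit.
Unset Printing Implicit Defensive.

(** * Cauchy-Schwarz for a symmetric positive semidefinite form *)

Section CauchySchwarz.
Variables (R : realType) (V : lmodType R) (ip : V -> V -> R).
Hypothesis ipC : forall E F, ip E F = ip F E.
Hypothesis ipP : forall a E F G, ip (a *: E + F) G = a * ip E G + ip F G.
Hypothesis ip_ge0 : forall E, 0 <= ip E E.

(** The form is nonnegative on every combination $aE+cF$; a suitable choice of $a$ and $c$ turns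
    this into the discriminant inequality. Definiteness is not assumed, so isotropic $F$ is a
    separate case. *)
Lemma ip_CauchySchwarz E F : ip E F ^+ 2 <= ip E E * ip F F.
Proof.
have expand a c : 0 <= a ^+ 2 * ip E E + (a * c) * (ip E F *+ 2) + c ^+ 2 * ip F F.
  have ip0 G : ip 0 G = 0.
    by have := ipP 1 0 0 G; rewrite scale1r addr0 mul1r => ?; lra.
  have ipr G b H K : ip G (b *: H + K) = b * ip G H + ip G K.
    by rewrite ipC ipP !(ipC G).
  have := ip_ge0 (a *: E + (c *: F + 0)).
  rewrite !(ipP, ipr) !(ipC _ 0) !ip0 (ipC F E) => h.
  apply: le_trans h _; rewrite le_eqVlt; apply/orP; left; apply/eqP; ring.
have [F0|F0] := eqVneq (ip F F) 0.
  have [->|EF0] := eqVneq (ip E F) 0; first by rewrite expr0n mulr_ge0.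
  (* If $F$ is isotropic the expansion is affine in $c$; this $c$ makes its value $-1$, a
     contradiction. *)
  have := expand 1 (- (ip E E + 1) / (ip E F *+ 2)).
  rewrite F0 !mulr0 expr1n !mul1r addr0 divfK ?mulrn_eq0// => h.
  by exfalso; lra.
have {F0} Fp : 0 < ip F F by rewrite lt_def F0 ip_ge0.
(* These coefficients make the expansion equal to [ip F F] times the difference of the two sides. *)
have := expand (ip F F) (- ip E F).
have -> : ip F F ^+ 2 * ip E E + ip F F * - ip E F * (ip E F *+ 2)
   + (- ip E F) ^+ 2 * ip F F = ip F F * (ip E E * ip F F - ip E F ^+ 2) by ring.
by rewrite pmulr_rge0// subr_ge0.
Qed.

End CauchySchwarz.

(** * The Frobenius inner product *)

Definition frob (R : realType) (m n : nat) (M N : 'M[R]_(m, n)) : R :=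
  \tr (M^T *m N).

Section Frobenius.
Variable R : realType.

Lemma frobE m n (M N : 'M[R]_(m, n)) : frob M N = \sum_i \sum_j M i j * N i j.
Proof.
rewrite exchange_big /= /frob /mxtrace; apply: eq_bigr => j _.
by rewrite mxE; apply: eq_bigr => i _; rewrite mxE.
Qed.

Lemma frobC m n (M N : 'M[R]_(m, n)) : frob M N = frob N M.
Proof. by rewrite /frob -mxtrace_tr trmx_mul trmxK. Qed.

Lemma frobP m n a (M N P : 'M[R]_(m, n)) :
  frob (a *: M + N) P = a * frob M P + frob N P.
Proof. by rewrite /frob linearP /= mulmxDl -scalemxAl linearP. Qed.

Lemma frobDl m n (M N P : 'M[R]_(m, n)) : frob (M + N) P = frob M P + frob N P.
Proof. by rewrite -[M]scale1r frobP mul1r scale1r. Qed.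

Lemma frobZl m n a (M P : 'M[R]_(m, n)) : frob (a *: M) P = a * frob M P.
Proof. by rewrite /frob linearZ /= -scalemxAl linearZ. Qed.

Lemma frobNl m n (M P : 'M[R]_(m, n)) : frob (- M) P = - frob M P.
Proof. by rewrite -scaleN1r frobZl mulN1r. Qed.

Lemma frobDr m n (M N P : 'M[R]_(m, n)) : frob P (M + N) = frob P M + frob P N.
Proof. by rewrite frobC frobDl !(frobC P). Qed.

Lemma frobZr m n a (M P : 'M[R]_(m, n)) : frob P (a *: M) = a * frob P M.
Proof. by rewrite frobC frobZl frobC. Qed.

Lemma frobNr m n (M P : 'M[R]_(m, n)) : frob P (- M) = - frob P M.
Proof. by rewrite frobC frobNl frobC. Qed.

Lemma frob0r m n (M : 'M[R]_(m, n)) : frob M 0 = 0.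
Proof. by rewrite /frob mulmx0 mxtrace0. Qed.

Lemma frob_mull m n p (P : 'M[R]_(m, p)) (M : 'M[R]_(p, n)) N :
  frob (P *m M) N = frob M (P^T *m N).
Proof. by rewrite /frob trmx_mul mulmxA. Qed.

Lemma frob_mulr m n p (P : 'M[R]_(p, n)) (M : 'M[R]_(m, p)) N :
  frob (M *m P) N = frob M (N *m P^T).
Proof. by rewrite /frob trmx_mul -mulmxA mxtrace_mulC mulmxA. Qed.

Lemma frob_trl m n (M : 'M[R]_(m, n)) N : frob M^T N = frob M N^T.
Proof. by rewrite /frob trmxK -trmx_mul mxtrace_tr mxtrace_mulC. Qed.

Lemma frob_ge0 m n (M : 'M[R]_(m, n)) : 0 <= frob M M.
Proof.
rewrite frobE; apply: sumr_ge0 => i _; apply: sumr_ge0 => j _.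
by rewrite -expr2 sqr_ge0.
Qed.

Lemma frob_eq0 m n (M : 'M[R]_(m, n)) : (frob M M == 0) = (M == 0).
Proof.
apply/eqP/eqP => [|->]; last exact: frob0r.
rewrite frobE => /eqP; rewrite psumr_eq0 => [/allP h|i _]; last first.
  by apply: sumr_ge0 => j _; rewrite -expr2 sqr_ge0.
apply/matrixP => i j; rewrite mxE.
have /implyP/(_ isT) := h i (mem_index_enum i).
rewrite psumr_eq0 => [/allP /(_ j (mem_index_enum j))|? _].
  by rewrite mulf_eq0 orbb => /eqP.
by rewrite -expr2 sqr_ge0.
Qed.

Lemma normF_sqr m n (M : 'M[R]_(m, n)) : normF M ^+ 2 = frob M M.
Proof.
have -> : normF M = Num.sqrt (frob M M).
  by rewrite /normF frobE.
by rewrite sqr_sqrtr// frob_ge0.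
Qed.

Lemma normF_ge0 m n (M : 'M[R]_(m, n)) : 0 <= normF M.
Proof. exact: sqrtr_ge0. Qed.

Lemma frob_CauchySchwarz m n (M N : 'M[R]_(m, n)) :
  `|frob M N| <= normF M * normF N.
Proof.
rewrite -ler_sqr ?nnegrE// ?mulr_ge0 ?normF_ge0//.
rewrite real_normK ?num_real// exprMn !normF_sqr; apply: ip_CauchySchwarz.
- exact: frobC.
- exact: frobP.
- exact: frob_ge0.
Qed.

End Frobenius.

(** * Maximum of a quadratic form on the Euclidean unit ball *)

Section QuadraticForm.
Variables (R : realType) (k : nat).

(** The form is continuous on the compact unit ball, so it has a maximizer there; homogeneity
    extends the bound to all $w$. The ball, unlike the sphere, is nonempty also for $k=0$. *)
Lemma quadratic_form_max (C : 'M[R]_k) :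
  exists2 w0 : 'cV[R]_k, frob w0 w0 <= 1 &
    forall w : 'cV[R]_k, frob (C *m w) w <= frob (C *m w0) w0 * frob w w.
Proof.
pose A : set 'rV[R]_k := [set u | frob u u <= 1].
pose f (u : 'rV[R]_k) := frob (C *m u^T) u^T.
have cfrob (D : 'M[R]_k) : continuous (fun u : 'rV[R]_k => frob (u *m D) u).
  have -> : (fun u : 'rV[R]_k => frob (u *m D) u) =
      fun u => \sum_i \sum_j (\sum_l u i l * D l j) * u i j.
    by apply/funext => u; rewrite frobE; under eq_bigr do under eq_bigr do rewrite mxE.
  have cadd : continuous (fun x : R * R => x.1 + x.2) by exact: add_continuous.
  apply: continuous_big => // i _; apply: continuous_big => // j _ u.
  apply: continuousM; last exact: coord_continuous.
  apply: (continuous_big (op := +%R)) => // l _ v.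
  by apply: continuousM; [exact: coord_continuous|exact: cst_continuous].
have cA : compact A.
  apply: bounded_closed_compact.
    exists 1; split; first exact: num_real.
    move=> M M1 u; rewrite /A /= => u1; rewrite [leLHS]/Num.norm /= mx_normrE.
    apply/bigmax_leP; split; first by lra.
    case=> i j _ /=; rewrite (le_trans _ (ltW M1))//.
    rewrite -[leRHS]normr1 -ler_sqr ?nnegrE//.
    rewrite !real_normK ?num_real// expr1n (le_trans _ u1)//.
    rewrite frobE (ord1 i) big_ord1 (bigD1 j)//= -expr2 lerDl sumr_ge0// => l _.
    by rewrite -expr2 sqr_ge0.
  have -> : A = (fun u : 'rV[R]_k => frob (u *m 1%:M) u) @^-1` [set x | x <= 1].
    by apply/seteqP; split=> u; rewrite /A /= mulmx1.
  apply: closed_comp; last exact: closed_le.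
  by move=> u _; exact: cfrob.
have cf : continuous f.
  have -> : f = fun u => frob (u *m C^T) u.
    by apply/funext => u; rewrite /f -[u in RHS]trmxK -trmx_mul frob_trl trmxK.
  exact: cfrob.
have A0 : A !=set0 by exists 0; rewrite /A /= frob0r.
have [u0 + u0max] := EVT_max_rV A0 cA (continuous_subspaceT cf).
rewrite inE /A /= => u0A.
exists u0^T; first by rewrite frob_trl trmxK.
move=> w; have [->|w0] := eqVneq w 0; first by rewrite mulmx0 !frob0r mulr0.
have nw : 0 < normF w.
  by rewrite lt_def normF_ge0 andbT -sqrf_eq0 normF_sqr frob_eq0.
(* Compare with the normalized vector $w/\|w\|$, which lies in the ball. *)
have := u0max ((normF w)^-1 *: w^T); rewrite inE /A /= /f.
rewrite frobZl frobZr frob_trl trmxK -normF_sqr linearZ /= trmxK -scalemxAr frobZl frobZr.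
have -> : (normF w)^-1 * ((normF w)^-1 * normF w ^+ 2) = 1.
  by rewrite expr2 mulKf ?mulVf// gt_eqF.
move=> /(_ (lexx _)) h.
by rewrite -ler_pdivrMr ?exprn_gt0// expr2 invfM mulrC -mulrA.
Qed.

End QuadraticForm.

(** * Norm of an operator with a known adjoint *)

Section OperatorNorm.
Variables (R : realType) (V : lmodType R) (ip : V -> V -> R).
Hypothesis ipC : forall E F, ip E F = ip F E.
Hypothesis ipP : forall a E F G, ip (a *: E + F) G = a * ip E G + ip F G.
Hypothesis ip_gt0 : forall E, E != 0 -> 0 < ip E E.
Variables (k : nat) (J : V -> 'cV[R]_k) (Js : 'cV[R]_k -> V) (C : 'M[R]_k).
Hypothesis adj : forall E w, frob (J E) w = ip E (Js w).
Hypothesis JJs : forall w, J (Js w) = C *m w.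

(** With $c^2$ the maximum of $\langle Cw,w\rangle=\|J^*w\|^2$ on the unit ball, attained at $w_0$,
    both the operator norm of $J$ and $\|C\|_2^{1/2}$ equal $c$. The ratio $c$ is reached at
    $E=J^*w_0$. *)
Lemma operator_norm_attained :
  let S := [set normF (J E) / Num.sqrt (ip E E) | E in [set E | E != 0]] in
  (S !=set0 -> S (sup S) /\ ubound S (sup S)) /\ sup S = Num.sqrt (norm2 C).
Proof.
move=> S.
have ip0 G : ip 0 G = 0.
  by have := ipP 1 0 0 G; rewrite scale1r addr0 mul1r => ?; lra.
have ip_ge0 E : 0 <= ip E E.
  by have [->|/ip_gt0/ltW//] := eqVneq E 0; rewrite ip0.
have [w0 w01 w0max] := quadratic_form_max C.
have qE w : frob (C *m w) w = ip (Js w) (Js w) by rewrite -JJs adj.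
pose c := Num.sqrt (frob (C *m w0) w0).
have c0 : 0 <= c by exact: sqrtr_ge0.
have c2 : c ^+ 2 = frob (C *m w0) w0 by rewrite sqr_sqrtr// qE.
have upJ E : normF (J E) <= c * Num.sqrt (ip E E).
  have [->|J0] := eqVneq (normF (J E)) 0; first by rewrite mulr_ge0 ?sqrtr_ge0.
  have Jp : 0 < normF (J E) by rewrite lt_def J0 normF_ge0.
  (* $\|JE\|^2=\langle E,J^*JE\rangle\le\|E\|\,\|J^*JE\|\le\|E\|\,c\,\|JE\|$; then $\|JE\|$
     cancels. *)
  rewrite -(ler_pM2l Jp) -expr2 normF_sqr adj.
  rewrite (le_trans (ler_norm _))// -ler_sqr ?nnegrE//; last first.
    by rewrite !mulr_ge0 ?sqrtr_ge0.
  rewrite real_normK ?num_real//.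
  rewrite (le_trans (ip_CauchySchwarz ipC ipP ip_ge0 _ _))//.
  rewrite !exprMn [Num.sqrt (ip E E) ^+ 2]sqr_sqrtr// mulrC mulrA ler_wpM2r// -qE.
  by rewrite (le_trans (w0max _))// c2 normF_sqr mulrC.
have n2C : norm2 C = c ^+ 2.
  have nw0 : normF w0 <= 1.
    by rewrite -ler_sqr ?nnegrE ?normF_ge0// normF_sqr expr1n.
  have ub : ubound [set normF (C *m v) | v in [set v : 'cV[R]_k | normF v <= 1]]
              (c ^+ 2).
    move=> _ [v /= v1 <-]; rewrite -JJs (le_trans (upJ _))// -qE expr2 ler_wpM2l//.
    rewrite -ler_sqr ?nnegrE ?sqrtr_ge0// [X in X <= _]sqr_sqrtr; last by rewrite qE.
    rewrite (le_trans (w0max _))// -c2 -[leRHS]mulr1 ler_wpM2l ?sqr_ge0//.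
    by rewrite -normF_sqr expr_le1// normF_ge0.
  apply/le_anti/andP; split.
    by apply: ge_sup ub; exists (normF (C *m w0)), w0.
  (* $c^2=\langle Cw_0,w_0\rangle\le\|Cw_0\|$ because $\|w_0\|\le1$. *)
  apply: (@le_trans _ _ (normF (C *m w0))).
    rewrite c2 (le_trans (ler_norm _))// (le_trans (frob_CauchySchwarz _ _))//.
    by rewrite -[leRHS]mulr1 ler_wpM2l ?normF_ge0.
  apply: ub_le_sup; first by exists (c ^+ 2).
  by exists w0.
have ubS : ubound S c.
  move=> _ [E /= E0 <-]; rewrite ler_pdivrMr ?sqrtr_gt0 ?ip_gt0//.
have Sc : S !=set0 -> S c.
  move=> [_ [E /= E0 _]].
  (* If $J^*w_0=0$ then $c=0$, and every nonzero $E$ attains it. *)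
  have [z|E00] := eqVneq (Js w0) 0.
    have cz : c = 0 by apply/eqP; rewrite -sqrf_eq0 c2 qE z ip0.
    exists E => //; apply/le_anti/andP; split; first by apply: ubS; exists E.
    by rewrite cz divr_ge0 ?normF_ge0 ?sqrtr_ge0.
  exists (Js w0) => //; apply/le_anti/andP; split; first by apply: ubS; exists (Js w0).
  rewrite ler_pdivlMr ?sqrtr_gt0 ?ip_gt0// -qE -/c -expr2 c2 JJs.
  rewrite (le_trans (ler_norm _))// (le_trans (frob_CauchySchwarz _ _))//.
  rewrite -[leRHS]mulr1 ler_wpM2l ?normF_ge0//.
  by rewrite -ler_sqr ?nnegrE ?normF_ge0// normF_sqr expr1n.
have supS : S !=set0 -> sup S = c.
  move=> S0; apply/le_anti/andP; split; first exact: ge_sup.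
  by apply: ub_le_sup; [exists c|exact: Sc].
split; first by move=> S0; rewrite supS//; split => //; exact: Sc.
rewrite n2C sqrtr_sqr ger0_norm//.
(* An empty [S] means that the space is trivial; then the supremum takes its default value 0, and
   $c=0$ too because $J^*w_0=0$. *)
have [/supS//|S0] := pselect (S !=set0).
have -> : S = set0 by apply/eqP; apply: contra_notT S0 => /set0P.
rewrite sup0; apply/esym/eqP; rewrite -sqrf_eq0 c2 qE.
have [->|E0] := eqVneq (Js w0) 0; first by rewrite ip0.
by exfalso; apply: S0; exists (normF (J (Js w0)) / Num.sqrt (ip (Js w0) (Js w0))), (Js w0).
Qed.

End OperatorNorm.

(** * Differentiability from a quadratic remainder bound *)

Section Differential.
Variables (R : realType) (V W : normedModType R).

Lemma is_diff_quadratic_remainder (f : V -> W) (df : {linear V -> W}) x (c1 c e0 : R) :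
  0 < e0 -> (forall E, `|df E| <= c1 * `|E|) ->
  (forall E, `|E| <= e0 -> `|f (x + E) - (f x + df E)| <= c * `|E| ^+ 2) ->
  is_diff x f df.
Proof.
move=> e0p dfb fb.
have dfc : continuous df.
  apply: bounded_linear_continuous; apply/linear_boundedP.
  exists c1; split; first exact: num_real.
  by move=> r cr E; rewrite (le_trans (dfb E))// ler_wpM2r// ltW.
have fo : f \o shift x = cst (f x) + df +o_ 0 id.
  apply/eqaddoP => _/posnumP[e].
  have pc : 0 < `|c| + 1 by rewrite ltr_wpDl.
  (* Within this radius $c\|E\|^2\le e\|E\|$; adding 1 to $|c|$ keeps the denominator positive. *)
  apply/nbhs_normP; exists (Num.min e0 (e%:num / (`|c| + 1))).
    by rewrite /= lt_min e0p divr_gt0.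
  move=> E /=; rewrite sub0r normrN lt_min => /andP[/ltW Ee0 /ltW Ec].
  rewrite [leLHS](_ : _ = `|f (x + E) - (f x + df E)|); last by rewrite (addrC x).
  rewrite (le_trans (fb E Ee0))// expr2 mulrA ler_wpM2r//.
  rewrite ler_pdivlMr// in Ec; rewrite (le_trans _ Ec)// mulrC ler_wpM2l//.
  by rewrite (le_trans (ler_norm _))// lerDl.
have dfE := diff_unique dfc fo.
by apply: DiffDef => //; apply/diff_locallyP; rewrite dfE.
Qed.

End Differential.

(** * Estimates for the entrywise maximum norm *)

Section MatrixNorm.
Variable R : realType.

Lemma ler_mx_norm_entry m n (M : 'M[R]_(m, n)) i j : `|M i j| <= `|M|.
Proof.
rewrite [leRHS]/Num.norm /= mx_normrE.
exact: (le_bigmax _ (fun ij : 'I_m * 'I_n => `|M ij.1 ij.2|) (i, j)).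
Qed.

Lemma mx_norm_leP m n (M : 'M[R]_(m, n)) c : 0 <= c ->
  (forall i j, `|M i j| <= c) -> `|M| <= c.
Proof.
move=> c0 h; rewrite [leLHS]/Num.norm /= mx_normrE.
by apply/bigmax_leP; split => // -[i j] _; exact: h.
Qed.

(** The maximum norm is not submultiplicative: an entry of the product is a sum of $p$ terms, whence
    the factor $p$. *)
Lemma ler_mx_normM m p n (M : 'M[R]_(m, p)) (N : 'M[R]_(p, n)) :
  `|M *m N| <= p%:R * `|M| * `|N|.
Proof.
apply: mx_norm_leP => [|i j]; first by rewrite !mulr_ge0.
rewrite mxE (le_trans (ler_norm_sum _ _ _))//.
have -> : p%:R * `|M| * `|N| = \sum_(l < p) `|M| * `|N|.
  by rewrite sumr_const card_ord -mulrA mulr_natl.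
by apply: ler_sum => l _; rewrite normrM ler_pM// ler_mx_norm_entry.
Qed.

Lemma mx_norm_tr_le m n (M : 'M[R]_(m, n)) c : `|M| <= c -> `|M^T| <= c.
Proof.
move=> Mc; apply: mx_norm_leP => [|i j]; first exact: le_trans Mc.
by rewrite mxE (le_trans (ler_mx_norm_entry _ _ _)).
Qed.

Lemma mx_norm_row_mx_le m n1 n2 (M : 'M[R]_(m, n1)) (N : 'M[R]_(m, n2)) c :
  `|M| <= c -> `|N| <= c -> `|row_mx M N| <= c.
Proof.
move=> Mc Nc; apply: mx_norm_leP => [|i j]; first exact: le_trans Mc.
by rewrite mxE; case: splitP => ? _; rewrite (le_trans (ler_mx_norm_entry _ _ _)).
Qed.

Lemma mx_norm_col_mx_le m1 m2 n (M : 'M[R]_(m1, n)) (N : 'M[R]_(m2, n)) c :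
  `|M| <= c -> `|N| <= c -> `|col_mx M N| <= c.
Proof.
move=> Mc Nc; apply: mx_norm_leP => [|i j]; first exact: le_trans Mc.
by rewrite mxE; case: splitP => ? _; rewrite (le_trans (ler_mx_norm_entry _ _ _)).
Qed.

End MatrixNorm.

(** * First-order perturbation of nonsingular linear systems *)

Lemma unitmx_ker (F : fieldType) (n : nat) (M : 'M[F]_n) :
  (forall v : 'cV[F]_n, M *m v = 0 -> v = 0) -> M \in unitmx.
Proof.
move=> M0; rewrite -unitmx_tr -row_free_unit -kermx_eq0; apply/eqP/row_matrixP => i.
rewrite row0 -[row i _]trmxK [(row i _)^T]M0 ?trmx0//.
by apply: trmx_inj; rewrite trmx_mul trmxK -row_mul mulmx_ker row0 trmx0.
Qed.

Section LinearSystem.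
Variables (R : realType) (N : nat) (M0 : 'M[R]_N) (c0 : 'cV[R]_N).
Hypothesis M0u : M0 \in unitmx.

(** With $P=M_0^{-1}$, the error of the first-order expansion is exactly $-PM_1(z-z_0)$, and $z-z_0$
    is itself $O(e)$, so the error is $O(e^2)$. The constants are uniform in the perturbation. *)
Lemma linear_system_perturbation :
  let z0 := invmx M0 *m c0 in
  exists2 e0 : R, 0 < e0 & exists2 K : R, 0 <= K &
  forall (M1 : 'M[R]_N) (c1 : 'cV[R]_N) e, `|M1| <= e -> `|c1| <= e -> e <= e0 ->
    M0 + M1 \in unitmx /\
    forall z, (M0 + M1) *m z = c0 + c1 ->
      `|z - (z0 + invmx M0 *m (c1 - M1 *m z0))| <= K * e ^+ 2.
Proof.
move=> z0; set P : 'M[R]_N := invmx M0.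
pose ka : R := N%:R * `|P| * N%:R.
have ka0 : 0 <= ka by rewrite !mulr_ge0.
pose mu : R := N%:R * `|P| * (1 + N%:R * `|z0|).
have mu0 : 0 <= mu by rewrite !mulr_ge0 ?addr_ge0 ?mulr_ge0.
have kaP (M1 : 'M[R]_N) (w : 'cV[R]_N) e : `|M1| <= e -> `|P *m (M1 *m w)| <= ka * e * `|w|.
  move=> M1e; rewrite (le_trans (ler_mx_normM _ _))//.
  rewrite /ka -!mulrA !ler_wpM2l// mulrA (le_trans (ler_mx_normM _ _))//.
  by rewrite ler_wpM2r// ler_wpM2l.
(* This threshold gives $ka\cdot e\le 1/2$, so that $PM_1$ is a contraction; the summand 1 covers
   $ka=0$. *)
exists (2 * ka + 1)^-1; first by rewrite invr_gt0; lra.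
exists (2 * ka * mu); first by rewrite !mulr_ge0.
move=> M1 c1 e M1e c1e ee0.
have e_ge0 : 0 <= e by exact: le_trans c1e.
have kae : ka * e <= 2^-1.
  have : e * (2 * ka + 1) <= 1 by rewrite -ler_pdivlMr ?div1r//; lra.
  by lra.
have half (w : 'cV[R]_N) : `|w| <= `|P *m (M1 *m w)| -> w = 0.
  move=> h; apply/eqP; rewrite -normr_le0.
  have := kaP M1 w e M1e; have : ka * e * `|w| <= 2^-1 * `|w| by rewrite ler_wpM2r.
  by lra.
split.
  apply: unitmx_ker => w /eqP; rewrite mulmxDl addr_eq0 => /eqP Mw.
  by apply: half; rewrite -{1}[w](mulKmx M0u) Mw mulmxN normrN.
move=> z Mz.
have zE : z = z0 + P *m (c1 - M1 *m z).
  rewrite -{1}[z](mulKmx M0u) -/P -mulmxDr; congr (P *m _).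
  by rewrite addrA -Mz mulmxDl addrK.
have res : z - (z0 + P *m (c1 - M1 *m z0)) = - (P *m (M1 *m (z - z0))).
  rewrite {1}zE opprD addrACA subrr add0r -mulmxBr opprB addrC.
  by rewrite addrA subrK -mulmxBr -[z0 - z]opprB !mulmxN.
rewrite res normrN.
(* $\|z-z_0\|\le mu\cdot e+\frac12\|z-z_0\|$, and the last term is absorbed on the left. *)
have del : `|z - z0| <= 2 * mu * e.
  have : z - z0 = P *m (c1 - M1 *m z0) - P *m (M1 *m (z - z0)).
    by rewrite -res opprD [z + (_ - _)]addrA [RHS]addrC subrK.
  have b1 : `|P *m (c1 - M1 *m z0)| <= mu * e.
    rewrite (le_trans (ler_mx_normM _ _))// /mu -[leRHS]mulrA ler_wpM2l ?mulr_ge0//.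
    rewrite (le_trans (ler_normB _ _))// mulrDl mul1r lerD//.
    by rewrite (le_trans (ler_mx_normM _ _))// mulrAC ler_wpM2l ?mulr_ge0.
  have b2 : `|P *m (M1 *m (z - z0))| <= 2^-1 * `|z - z0|.
    by rewrite (le_trans (kaP _ _ _ M1e))// ler_wpM2r.
  move=> /(congr1 (@Num.norm _ _)) dE.
  have : `|z - z0| <= mu * e + 2^-1 * `|z - z0|.
    by rewrite {1}dE (le_trans (ler_normB _ _))// lerD.
  by lra.
rewrite (le_trans (kaP _ _ _ M1e))//.
have -> : 2 * ka * mu * e ^+ 2 = ka * e * (2 * mu * e) by ring.
by rewrite ler_wpM2l ?mulr_ge0.
Qed.

End LinearSystem.

(** * The augmented system and the formal derivative of its solution *)

Section AugmentedSystem.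
Variable R : realType.

(* With [c = 1] the matrix of the system for (r, l, x); with [c = 0] its increment
   when the data are perturbed by (A, B). *)
Definition aug_mx (m n s : nat) (A : 'M[R]_(m, n)) (B : 'M[R]_(s, n)) (c : R) :
    'M[R]_(m + (s + n)) :=
  col_mx (row_mx c%:M (row_mx 0 A))
    (col_mx (row_mx 0 (row_mx 0 B)) (row_mx A^T (row_mx (- B^T) 0))).

Lemma aug_mx_mul m n s (A : 'M[R]_(m, n)) (B : 'M[R]_(s, n)) c
    (r : 'cV[R]_m) (l : 'cV[R]_s) (x : 'cV[R]_n) :
  aug_mx A B c *m col_mx r (col_mx l x) =
  col_mx (c *: r + A *m x) (col_mx (B *m x) (A^T *m r - B^T *m l)).
Proof.
by rewrite /aug_mx !mul_col_mx !mul_row_col !mul0mx mul_scalar_mx !add0r addr0 mulNmx.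
Qed.

Lemma aug_mxD m n s (A A' : 'M[R]_(m, n)) (B B' : 'M[R]_(s, n)) c c' :
  aug_mx (A + A') (B + B') (c + c') = aug_mx A B c + aug_mx A' B' c'.
Proof.
by rewrite /aug_mx !add_col_mx !add_row_mx !addr0 !raddfD.
Qed.

Lemma mpinv_row_free n s (B : 'M[R]_(s, n)) : row_free B -> B *m mpinv B = 1%:M.
Proof.
move=> /row_freeP[N BN]; have [BHB _ _ _] := mpinvP B.
by rewrite -[B *m _]mulmx1 -BN mulmxA BHB.
Qed.

(** The closed formula satisfies the optimality conditions as soon as $B$ has full row rank, so this
    also applies to perturbed data. The projector $P$ onto $\ker B$ annihilates $A^Tr$, which
    therefore lies in the range of $B^T$. *)
Lemma lse_sol_kkt m n s (A : 'M[R]_(m, n)) (B : 'M[R]_(s, n)) b d :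
  row_free B -> B *m lse_sol A B b d = d /\
    exists l, A^T *m (b - A *m lse_sol A B b d) = B^T *m l.
Proof.
move=> /mpinv_row_free BH.
have [_ _ _] := mpinvP B.
rewrite /lse_sol /wpinv /lse_proj; set H := mpinv B in BH * => HBT.
set P := 1%:M - H *m B.
have BP : B *m P = 0 by rewrite mulmxBr mulmx1 mulmxA BH mul1mx subrr.
have PT : P^T = P by rewrite /P linearB /= trmx1 HBT.
have [MGM GMG MGT GMT] := mpinvP (A *m P).
set G := mpinv (A *m P) in MGM GMG MGT GMT *.
(* $G=(GAP)^TG$ begins with the factor $P$, and $BP=0$. *)
have BG : B *m G = 0.
  by rewrite -GMG -GMT !trmx_mul PT !mulmxA BP !mul0mx.
have PG : P *m G = G by rewrite mulmxBl mul1mx -mulmxA BG mulmx0 subr0.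
split.
  rewrite mulmxDr !mulmxA BG mul0mx add0r mulmxBr mulmx1 mulmxA BG mul0mx subr0.
  by rewrite BH mul1mx.
(* $PA^Tr=0$ reads $A^Tr=HBA^Tr$, and $HB=B^TH^T$; this gives the multiplier $H^TA^Tr$. *)
set x : 'cV[R]_n := G *m b + _; exists (H^T *m (A^T *m (b - A *m x))).
have rE : b - A *m x = (1%:M - (A *m P) *m G) *m (b - A *m (H *m d)).
  have -> : (1%:M - (A *m P) *m G) *m (b - A *m (H *m d)) =
      b - A *m (G *m b) - (1%:M - A *m G) *m (A *m (H *m d)).
    by rewrite -(mulmxA A) PG mulmxBr (mulmxBl _ _ b) mul1mx -[A *m G *m b]mulmxA.
  rewrite /x mulmxDr opprD addrA; congr (_ - _).
  by rewrite !mulmxA mulmxBr mulmx1 (mulmxBl _ _ A) mul1mx !mulmxA.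
have : P *m (A^T *m (b - A *m x)) = 0.
  have APG : (A *m P)^T *m (1%:M - A *m P *m G) = 0.
    by rewrite mulmxBr mulmx1 -MGT -trmx_mul MGM subrr.
  by rewrite mulmxA -{1}PT -trmx_mul rE mulmxA APG mul0mx.
rewrite {1}/P mulmxBl mul1mx => /eqP; rewrite subr_eq0 => /eqP {1}->.
by rewrite -HBT trmx_mul -!mulmxA.
Qed.

End AugmentedSystem.

(* [Q] and [W] stand for (AP)^+ ((AP)^+)^T and B_A^+; the identities
   QB, QAWB and BW are all that is needed of them. *)
Definition lse_deriv (R : realType) (m n s k : nat) (L : 'M[R]_(n, k))
    (A : 'M[R]_(m, n)) (Q : 'M[R]_n) (W : 'M[R]_(n, s))
    (r : 'cV[R]_m) (l : 'cV[R]_s) (x : 'cV[R]_n) (E : lse_data R m n s) : 'cV[R]_k :=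
  let: (dA, dB, db, dd) := E in
  L^T *m (Q *m A^T *m (db - dA *m x) + W *m (dd - dB *m x)
          + Q *m (dA^T *m r - dB^T *m l)).

Lemma lse_deriv_linear (R : realType) m n s k (L : 'M[R]_(n, k)) A Q W r l x :
  linear (@lse_deriv R m n s k L A Q W r l x).
Proof.
move=> a [[[dA dB] db] dd] [[[eA eB] eb] ed] /=.
have h1 : a *: db + eb - (a *: dA + eA) *m x = a *: (db - dA *m x) + (eb - eA *m x).
  by rewrite mulmxDl -scalemxAl scalerBr opprD addrACA.
have h2 : a *: dd + ed - (a *: dB + eB) *m x = a *: (dd - dB *m x) + (ed - eB *m x).
  by rewrite mulmxDl -scalemxAl scalerBr opprD addrACA.
have h3 : (a *: dA + eA)^T *m r - (a *: dB + eB)^T *m l =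
    a *: (dA^T *m r - dB^T *m l) + (eA^T *m r - eB^T *m l).
  by rewrite !linearP /= !mulmxDl -!scalemxAl scalerBr opprD addrACA.
rewrite {}h1 {}h2 {}h3.
move: (db - _) (eb - _) (dd - _) (ed - _) (_ - dB^T *m l) (_ - eB^T *m l).
move=> u1 u2 v1 v2 w1 w2; rewrite !mulmxDr -!scalemxAr !scalerDr.
by rewrite [RHS]addrACA; congr (_ + _); exact: addrACA.
Qed.

(** * Fréchet differentiability of the solution map *)

Section Differentiability.
Variables (R : realType) (m n s : nat).
Variables (A : 'M[R]_(m, n)) (B : 'M[R]_(s, n)) (b : 'cV[R]_m) (d : 'cV[R]_s).
Variables (Q : 'M[R]_n) (W : 'M[R]_(n, s)).
Hypothesis QB : Q *m B^T = 0.
Hypothesis QAWB : Q *m A^T *m A + W *m B = 1%:M.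
Hypothesis BW : B *m W = 1%:M.

(** Explicit inversion of the augmented system: [QAWB] recovers $x$ while [QB] removes the
    multiplier, and the transpose of [BW] recovers $l$. *)
Lemma aug_solve (r : 'cV[R]_m) (l : 'cV[R]_s) (x : 'cV[R]_n) f h e :
  r + A *m x = f -> B *m x = h -> A^T *m r - B^T *m l = e ->
  x = Q *m A^T *m f + W *m h - Q *m e /\ l = W^T *m (A^T *m r - e).
Proof.
move=> <- <- <-; split.
  rewrite mulmxBr (mulmxA Q B^T) QB mul0mx subr0 mulmxDr (mulmxA Q) addrAC.
  by rewrite [_ + _ - _]addrAC subrr add0r !mulmxA -mulmxDl QAWB mul1mx.
by rewrite opprB addrC subrK mulmxA -trmx_mul BW trmx1 mul1mx.
Qed.

Lemma aug_mx_unit : aug_mx A B 1 \in unitmx.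
Proof.
apply: unitmx_ker => v; rewrite -[v]vsubmxK -[dsubmx v]vsubmxK aug_mx_mul scale1r.
set r := usubmx v; set l := usubmx _; set x := dsubmx _.
rewrite -[0]vsubmxK -[dsubmx 0]vsubmxK !linear0 => /eq_col_mx[e1 /eq_col_mx[e2 e3]].
have [x0 l0] := aug_solve e1 e2 e3.
have {}x0 : x = 0 by rewrite x0 !mulmx0 addr0 subr0.
have r0 : r = 0 by rewrite -e1 x0 mulmx0 addr0.
by rewrite l0 r0 x0 mulmx0 subr0 mulmx0 !col_mx0.
Qed.

Variables (l : 'cV[R]_s) (x : 'cV[R]_n).
Hypothesis Bx : B *m x = d.
Hypothesis Al : A^T *m (b - A *m x) = B^T *m l.

(** [aug_solve] expresses $x$ through $b$ and $d$ alone, so all points satisfying the optimality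
    conditions coincide. *)
Lemma kkt_lse_sol : x = lse_sol A B b d.
Proof.
have Bf : row_free B by apply/row_freeP; exists W.
have [Bx' [l' Al']] := lse_sol_kkt A b d Bf.
have Al0 : A^T *m (b - A *m x) - B^T *m l = 0 by rewrite Al subrr.
move: (lse_sol A B b d) Bx' Al' => x' Bx' Al'.
have Al0' : A^T *m (b - A *m x') - B^T *m l' = 0 by rewrite Al' subrr.
have [-> _] := aug_solve (subrK _ b) Bx Al0.
by have [-> _] := aug_solve (subrK _ b) Bx' Al0'.
Qed.

Variables (k : nat) (L : 'M[R]_(n, k)).
Let r := b - A *m x.

(** Apply [linear_system_perturbation] to the augmented system, whose matrix and right-hand side
    have increments linear in the data. [aug_solve] identifies the last block of the first-order
    term with the candidate derivative. *)
Lemma is_diff_lse_map :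
  is_diff ((A, B, b, d) : lse_data R m n s) (lse_map L) (lse_deriv L A Q W r l x).
Proof.
pose D : lse_data R m n s := (A, B, b, d).
pose M0 := aug_mx A B 1.
pose c0 := col_mx b (col_mx d (0 : 'cV[R]_n)).
pose M1 (E : lse_data R m n s) := let: (dA, dB, db, dd) := E in aug_mx dA dB 0.
pose c1 (E : lse_data R m n s) :=
  let: (dA, dB, db, dd) := E in col_mx db (col_mx dd (0 : 'cV[R]_n)).
have M0u : M0 \in unitmx := aug_mx_unit.
pose z0 := col_mx r (col_mx l x).
have z0E : invmx M0 *m c0 = z0.
  apply: (can_inj (mulKmx M0u)); rewrite mulKVmx// /M0 /z0 aug_mx_mul scale1r.
  by rewrite subrK Bx Al subrr.
(* The product norm on the data is the maximum of the norms of the components, and these are the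
   blocks of [M1 E] and [c1 E] up to sign and transposition. *)
have E_le E : `|M1 E| <= `|E| /\ `|c1 E| <= `|E|.
  case: E => [[[dA dB] db] dd]; set e := `|(dA, dB, db, dd)|.
  have e0 : 0 <= e by exact: normr_ge0.
  have [[dAe dBe] [dbe dde]] : (`|dA| <= e /\ `|dB| <= e) /\ (`|db| <= e /\ `|dd| <= e).
    have -> : e = Num.max (Num.max (Num.max `|dA| `|dB|) `|db|) `|dd| by [].
    by rewrite !le_max !lexx !orbT.
  split; rewrite /M1 /c1 /aug_mx.
    rewrite raddf0.
    by do !(apply: mx_norm_col_mx_le || apply: mx_norm_row_mx_le);
      rewrite ?normr0 ?normrN//; apply: mx_norm_tr_le.
  by do !apply: mx_norm_col_mx_le; rewrite ?normr0.
pose hx (E : lse_data R m n s) := dsubmx (dsubmx (invmx M0 *m (c1 E - M1 E *m z0))).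
have hxE E : lse_deriv L A Q W r l x E = L^T *m hx E.
  rewrite /hx; set h := invmx M0 *m _.
  have : M0 *m h = c1 E - M1 E *m z0 by rewrite mulKVmx.
  rewrite -[X in M0 *m X]vsubmxK -[X in M0 *m col_mx _ X]vsubmxK /M0 aug_mx_mul.
  case: E @h => [[[dA dB] db] dd] h.
  rewrite /M1 /c1 /z0 aug_mx_mul scale0r add0r !opp_col_mx !add_col_mx scale1r.
  move=> /eq_col_mx[e1 /eq_col_mx[e2 e3]].
  have [-> _] := aug_solve e1 e2 e3.
  by rewrite /lse_deriv sub0r mulmxN opprK.
have [e0 e0p [K K0 pert]] := linear_system_perturbation c0 M0u.
rewrite z0E in pert.
have sub_le (v : 'cV[R]_(m + (s + n))) : `|dsubmx (dsubmx v)| <= `|v|.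
  by apply: mx_norm_leP => // i j; rewrite !mxE ler_mx_norm_entry.
pose lL := GRing.isLinear.Build _ _ _ _ _ (lse_deriv_linear L A Q W r l x).
pose dL : {linear lse_data R m n s -> 'cV[R]_k} :=
  HB.pack (lse_deriv L A Q W r l x) lL.
have cL (v : 'cV[R]_n) : `|L^T *m v| <= n%:R * `|L^T| * `|v| by exact: ler_mx_normM.
pose N := (m + (s + n))%N.
apply: (@is_diff_quadratic_remainder _ _ _ (lse_map L) dL D
  (n%:R * `|L^T| * (N%:R * `|invmx M0| * (1 + N%:R * `|z0|)))
  (n%:R * `|L^T| * K) e0 e0p).
  move=> E; rewrite /= hxE (le_trans (cL _))// -!(mulrA (n%:R * `|L^T|)).
  rewrite ler_wpM2l ?mulr_ge0// (le_trans (sub_le _))//.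
  rewrite (le_trans (ler_mx_normM _ _))// -!(mulrA (N%:R * _)) ler_wpM2l ?mulr_ge0//.
  have [M1E c1E] := E_le E.
  rewrite (le_trans (ler_normB _ _))// mulrDl mul1r lerD//.
  by rewrite (le_trans (ler_mx_normM _ _))// mulrAC ler_wpM2l ?mulr_ge0.
move=> E Ee0; have [M1E c1E] := E_le E.
have [Mu {}pert] := pert (M1 E) (c1 E) `|E| M1E c1E Ee0.
(* It remains to complete the closed formula at the perturbed data to a solution of the perturbed
   system. *)
suff [z' Mz' zx] : exists2 z', (M0 + M1 E) *m z' = c0 + c1 E &
    lse_map L (D + E) = L^T *m dsubmx (dsubmx z').
  have -> : lse_map L (D + E) - (lse_map L D + dL E) =
      L^T *m (dsubmx (dsubmx z') - (x + hx E)).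
    by rewrite zx mulmxBr mulmxDr {1}kkt_lse_sol -hxE.
  rewrite (le_trans (cL _))//.
  rewrite -[leRHS]mulrA ler_wpM2l ?mulr_ge0// (le_trans _ (pert _ Mz'))//.
  rewrite /hx; move: (invmx M0 *m _) => h.
  suff -> : dsubmx (dsubmx z') - (x + dsubmx (dsubmx h)) =
    dsubmx (dsubmx (z' - (z0 + h))) by exact: sub_le.
  by rewrite !linearB /= !linearD /= /z0 !col_mxKd.
case: E Mu {Ee0 M1E c1E pert} => [[[dA dB] db] dd].
rewrite /M0 /M1 -aug_mxD addr0 => Mu.
(* A left kernel vector $y$ of $B+dB$ would give the kernel vector $(0,y^T,0)$ of the perturbed
   augmented matrix, which is invertible. *)
have Bf : row_free (B + dB).
  rewrite -kermx_eq0; apply/eqP/row_matrixP => i; rewrite row0.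
  have kr0 : row i (kermx (B + dB)) *m (B + dB) = 0 by rewrite -row_mul mulmx_ker row0.
  set y := row i _ in kr0 *; pose v := col_mx (0 : 'cV[R]_m) (col_mx y^T (0 : 'cV[R]_n)).
  have : aug_mx (A + dA) (B + dB) 1 *m v = 0.
    rewrite /v aug_mx_mul scaler0 !mulmx0 addr0 sub0r -trmx_mul kr0 trmx0 oppr0.
    by rewrite !col_mx0.
  move=> /(congr1 (mulmx (invmx (aug_mx (A + dA) (B + dB) 1)))).
  rewrite mulKmx// mulmx0 /v => /(congr1 (fun u => usubmx (dsubmx u))).
  rewrite col_mxKd col_mxKu !linear0 => /(congr1 trmx).
  by rewrite trmxK trmx0.
have [Bx' [l' Al']] := lse_sol_kkt (A + dA) (b + db) (d + dd) Bf.
set x' := lse_sol _ _ _ _ in Bx' Al'.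
exists (col_mx (b + db - (A + dA) *m x') (col_mx l' x')).
  rewrite aug_mx_mul scale1r subrK Bx' Al' subrr.
  by rewrite /c0 /c1 !add_col_mx addr0.
by rewrite !col_mxKd.
Qed.

End Differentiability.

(** * Optimality of the solution, the adjoint of the derivative and its Gram matrix *)

Section LeastSquaresSolution.
Variables (R : realType) (m n s : nat).
Variables (A : 'M[R]_(m, n)) (B : 'M[R]_(s, n)) (b : 'cV[R]_m) (d : 'cV[R]_s).
Variables (Q : 'M[R]_n) (W : 'M[R]_(n, s)).
Hypothesis QB : Q *m B^T = 0.
Hypothesis QAWB : Q *m A^T *m A + W *m B = 1%:M.
Hypothesis BW : B *m W = 1%:M.

(** Let $y$ be the closed formula. Its residual is orthogonal to $A(x-y)$ since $B(x-y)=0$, so by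
    Pythagoras minimality of $x$ forces $A(x-y)=0$; then [QAWB] gives $x=y$. *)
Lemma lse_solution_kkt x : is_lse_solution A B b d x ->
  exists l, A^T *m (b - A *m x) = B^T *m l.
Proof.
move=> [Bx xmin].
have Bf : row_free B by apply/row_freeP; exists W.
have [] := lse_sol_kkt A b d Bf.
move: (lse_sol A B b d) => y By [l Al]; exists l.
suff -> : x = y by [].
have Bu : B *m (x - y) = 0 by rewrite mulmxBr Bx By subrr.
have orth : frob (A *m (x - y)) (b - A *m y) = 0.
  by rewrite frob_mull Al -frob_mull Bu frobC frob0r.
have Au : A *m (x - y) = 0.
  apply/eqP; rewrite -frob_eq0 eq_le frob_ge0 andbT.
  have := xmin y By; rewrite -ler_sqr ?nnegrE ?normF_ge0// !normF_sqr.
  have -> : b - A *m x = (b - A *m y) - A *m (x - y).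
    by rewrite mulmxBr opprB addrA subrK.
  move: (b - A *m y) (A *m (x - y)) orth => u v uv.
  rewrite !(frobDl, frobDr, frobNl, frobNr) (frobC u v) uv; lra.
apply/eqP; rewrite -subr_eq0 -[x - y]mul1mx -QAWB mulmxDl -!mulmxA Bu Au.
by rewrite !mulmx0 addr0.
Qed.

Hypothesis Qsym : Q^T = Q.
Variables (l : 'cV[R]_s) (x : 'cV[R]_n).
Hypothesis Bx : B *m x = d.
Hypothesis Al : A^T *m (b - A *m x) = B^T *m l.
Let r := b - A *m x.
Variables (k : nat) (L : 'M[R]_(n, k)) (aA aB ab ad : R).
Hypotheses (aA0 : 0 < aA) (aB0 : 0 < aB) (ab0 : 0 < ab) (ad0 : 0 < ad).

(** The inner product whose norm is [wnormF]. *)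
Let ip (E F : lse_data R m n s) : R :=
  let: (dA, dB, db, dd) := E in let: (eA, eB, eb, ed) := F in
  aA ^+ 2 * frob dA eA + aB ^+ 2 * frob dB eB
  + ab ^+ 2 * frob db eb + ad ^+ 2 * frob dd ed.

Let ipC E F : ip E F = ip F E.
Proof.
case: E => [[[dA dB] db] dd]; case: F => [[[eA eB] eb] ed] /=.
by rewrite (frobC dA) (frobC dB) (frobC db) (frobC dd).
Qed.

Let ipP a E F G : ip (a *: E + F) G = a * ip E G + ip F G.
Proof.
case: E => [[[dA dB] db] dd]; case: F => [[[eA eB] eb] ed].
by case: G => [[[fA fB] fb] fd] /=; rewrite !frobP; ring.
Qed.

Let ip_gt0 E : E != 0 -> 0 < ip E E.
Proof.
have sqr_frob_ge0 a p q (M : 'M[R]_(p, q)) : 0 <= a ^+ 2 * frob M M.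
  by rewrite mulr_ge0 ?sqr_ge0 ?frob_ge0.
have sqr_frob_eq0 a p q (M : 'M[R]_(p, q)) : 0 < a ->
    (a ^+ 2 * frob M M == 0) = (M == 0).
  by move=> a0; rewrite mulf_eq0 frob_eq0 sqrf_eq0 gt_eqF.
case: E => [[[dA dB] db] dd] E0 /=; rewrite lt_def !addr_ge0// andbT.
apply: contra E0; rewrite !paddr_eq0 ?addr_ge0// !sqr_frob_eq0//.
Qed.

(** Each component collects the factors paired with one perturbation in $\langle JE,w\rangle$; the
    inverse squares cancel the weights of [ip]. *)
Let adjoint (w : 'cV[R]_k) : lse_data R m n s :=
  let v := L *m w in
  (aA ^- 2 *: (r *m (Q *m v)^T - A *m (Q *m v) *m x^T),
   aB ^- 2 *: (- (l *m (Q *m v)^T) - W^T *m v *m x^T),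
   ab ^- 2 *: (A *m (Q *m v)), ad ^- 2 *: (W^T *m v)).

Let adjointP E w : frob (lse_deriv L A Q W r l x E) w = ip E (adjoint w).
Proof.
case: E => [[[dA dB] db] dd] /=; rewrite frob_mull trmxK; set v := L *m w.
rewrite 2!frobDl (frob_mull (Q *m A^T)) (frob_mull W) (frob_mull Q).
rewrite trmx_mul trmxK Qsym -[A *m Q *m v]mulmxA; set y := Q *m v.
rewrite !frobDl !frobNl !(frob_mulr x) (frob_mulr r) (frob_mulr l).
rewrite (frob_trl dA) (frob_trl dB) (trmx_mul y) (trmx_mul y) !trmxK !frobZr.
rewrite !mulVKf ?sqrf_eq0 ?gt_eqF// !(frobDr, frobNr); ring.
Qed.

Definition lse_gram : 'M[R]_k :=
  L^T *m ((normF r ^+ 2 / aA ^+ 2 + normF l ^+ 2 / aB ^+ 2) *: (Q *m Q)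
          + (normF x ^+ 2 / aA ^+ 2 + 1 / ab ^+ 2) *: Q
          + (normF x ^+ 2 / aB ^+ 2 + 1 / ad ^+ 2) *: (W *m W^T)
          + (1 / aB ^+ 2) *: (Q *m x *m (W *m l)^T + W *m l *m (Q *m x)^T)) *m L.

Let sqr_mx p (u : 'cV[R]_p) : u^T *m u = (normF u ^+ 2)%:M.
Proof. by rewrite normF_sqr /frob trace_mx11 -mx11_scalar. Qed.

Let dotC p (u v : 'cV[R]_p) : u^T *m v = v^T *m u.
Proof. by rewrite [LHS]mx11_scalar -tr_scalar_mx -mx11_scalar trmx_mul trmxK. Qed.

Let trZ p q a (M : 'M[R]_(p, q)) : (a *: M)^T = a *: M^T.
Proof. exact: linearZ. Qed.

Let trN p q (M : 'M[R]_(p, q)) : (- M)^T = - M^T.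
Proof. exact: linearN. Qed.

Let trD p q (M N : 'M[R]_(p, q)) : (M + N)^T = M^T + N^T.
Proof. exact: linearD. Qed.

Let trB p q (M N : 'M[R]_(p, q)) : (M - N)^T = M^T - N^T.
Proof. exact: linearB. Qed.

(** This is the computation of $JJ^*$. It simplifies through $QA^Tr=QB^Tl=0$ and $QA^TAQ=Q$; the
    mixed terms in $x$ and $l$ that survive come from the perturbation of $B$. *)
Let derivK w : lse_deriv L A Q W r l x (adjoint w) = lse_gram *m w.
Proof.
rewrite /lse_gram -!mulmxA /= -/r; congr (L^T *m _).
have QAr : Q *m A^T *m r = 0 by rewrite -mulmxA Al mulmxA QB mul0mx.
have QAA u : Q *m A^T *m (A *m (Q *m u)) = Q *m u.
  have BQ : B *m Q = 0 by rewrite -[B]trmxK -Qsym -trmx_mul QB trmx0.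
  rewrite 2!mulmxA; have -> : Q *m A^T *m A = 1%:M - W *m B by rewrite -QAWB addrK.
  by rewrite mulmxBl mul1mx -mulmxA BQ mulmx0 subr0.
move: (L *m w) => v; have [y yE] : exists y, y = Q *m v by exists (Q *m v).
have QAy : Q *m A^T *m (A *m y) = y by rewrite yE QAA.
have yAr : (A *m y)^T *m r = 0.
  by rewrite yE !trmx_mul Qsym -!mulmxA (mulmxA Q) QAr mulmx0.
rewrite -yE.
(* [e1], [e2] and [e3] evaluate the three summands of [lse_deriv] at the adjoint. *)
have e1 : Q *m A^T *m (ab ^- 2 *: (A *m y)
    - aA ^- 2 *: (r *m y^T - A *m y *m x^T) *m x) =
    (normF x ^+ 2 / aA ^+ 2 + 1 / ab ^+ 2) *: y.
  rewrite mulmxBr -scalemxAr QAy -scalemxAl -scalemxAr mulmxBl mulmxBr.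
  rewrite -[r *m _ *m x]mulmxA (mulmxA _ r) QAr mul0mx sub0r -[_ *m x^T *m x]mulmxA sqr_mx.
  rewrite mul_mx_scalar -scalemxAr QAy scalerN opprK scalerA -scalerDl.
  by congr (_ *: _); rewrite div1r addrC mulrC.
have e2 : W *m (ad ^- 2 *: (W^T *m v)
    - aB ^- 2 *: (- (l *m y^T) - W^T *m v *m x^T) *m x) =
    (normF x ^+ 2 / aB ^+ 2 + 1 / ad ^+ 2) *: (W *m (W^T *m v))
    + (1 / aB ^+ 2) *: (W *m (l *m (y^T *m x))).
  rewrite -scalemxAl mulmxBr -!scalemxAr mulmxBl mulNmx -opprD mulmxN scalerN opprK.
  rewrite -!(mulmxA _ x^T x) sqr_mx mul_mx_scalar mulmxDr -scalemxAr scalerDr.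
  rewrite scalerA -(mulmxA l) addrA addrAC -scalerDl !div1r.
  by congr (_ *: _ + _); rewrite addrC mulrC.
have e3 : Q *m ((aA ^- 2 *: (r *m y^T - A *m y *m x^T))^T *m r
    - (aB ^- 2 *: (- (l *m y^T) - W^T *m v *m x^T))^T *m l) =
    (normF r ^+ 2 / aA ^+ 2 + normF l ^+ 2 / aB ^+ 2) *: (Q *m y)
    + (1 / aB ^+ 2) *: (Q *m (x *m ((W^T *m v)^T *m l))).
  have tA : (aA ^- 2 *: (r *m y^T - A *m y *m x^T))^T *m r = (normF r ^+ 2 / aA ^+ 2) *: y.
    rewrite trZ -scalemxAl trB !(trmx_mul _ (_^T)) !trmxK mulmxBl -!mulmxA yAr mulmx0 subr0.
    by rewrite sqr_mx mul_mx_scalar scalerA mulrC.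
  have tB : (aB ^- 2 *: (- (l *m y^T) - W^T *m v *m x^T))^T *m l =
      - ((normF l ^+ 2 / aB ^+ 2) *: y + aB ^- 2 *: (x *m ((W^T *m v)^T *m l))).
    rewrite -opprD scalerN trN trZ mulNmx -scalemxAl trD !(trmx_mul _ (_^T)) !trmxK.
    by rewrite mulmxDl -!mulmxA sqr_mx mul_mx_scalar scalerDr scalerA mulrC.
  rewrite tA tB opprK addrA -scalerDl mulmxDr -!scalemxAr.
  by rewrite div1r.
rewrite e1 e2 e3 !mulmxDl -!scalemxAl -!mulmxA -yE mulmxDl -!mulmxA.
have yx : (Q *m x)^T *m v = y^T *m x.
  by rewrite dotC yE trmx_mul Qsym mulmxA.
have lx : (W *m l)^T *m v = (W^T *m v)^T *m l.
  by rewrite dotC trmx_mul trmxK mulmxA.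
rewrite yx lx scalerDr.
set t1 := _ *: y; set t2 := _ *: (W *m (W^T *m v)).
set t3 := _ *: (W *m (l *m _)); set t4 := _ *: (Q *m y); set t5 := _ *: (Q *m (x *m _)).
by rewrite [LHS]addrC (addrA t1) addrACA (addrA t4).
Qed.

Lemma lse_condition_number :
  let D : lse_data R m n s := (A, B, b, d) in
  let ratios := cond_ratios L aA aB ab ad D in
  let kappa := kappaLSE L aA aB ab ad D in
  [/\ differentiable (lse_map L : lse_data R m n s -> _) D,
      ratios !=set0 -> ratios kappa /\ ubound ratios kappa
    & kappa = Num.sqrt (norm2 lse_gram)].
Proof.
move=> D ratios kappa.
have dL := is_diff_lse_map QB QAWB BW Bx Al L.
have ratiosE : ratios =
    [set normF (lse_deriv L A Q W r l x E) / Num.sqrt (ip E E)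
      | E in [set E : lse_data R m n s | E != 0]].
  apply: eq_imagel => E _; rewrite (diff_val (is_diff_def := dL)).
  by case: E => [[[dA dB] db] dd]; rewrite /wnormF !normF_sqr.
have [Smax supS] := operator_norm_attained ipC ipP ip_gt0 adjointP derivK.
split; first exact: ex_diff.
  by rewrite /kappa /kappaLSE -/ratios ratiosE.
by rewrite /kappa /kappaLSE -/ratios ratiosE.
Qed.

End LeastSquaresSolution.

(** * Algebra of the padded blocks and the inverse of $\Lambda_1$ *)

Section PaddedMatrix.
Variables (R : realType) (t : nat).

Lemma padmx_mul p q r (M N : 'M[R]_t) : (t <= q)%N ->
  padmx p q M *m padmx q r N = padmx p r (M *m N).
Proof.
move=> tq; rewrite /padmx !mulmxA -[_ *m pid_mx t *m pid_mx t]mulmxA pid_mx_id//.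
by rewrite pid_mx_1 mulmx1.
Qed.

Lemma padmx_copid p q (M : 'M[R]_t) : (t <= q)%N ->
  padmx p q M *m copid_mx t = 0.
Proof. by move=> tq; rewrite /padmx -mulmxA mul_pid_mx_copid// mulmx0. Qed.

Lemma copid_padmx p q (M : 'M[R]_t) : (t <= p)%N ->
  copid_mx t *m padmx p q M = 0.
Proof. by move=> tp; rewrite /padmx !mulmxA mul_copid_mx_pid// !mul0mx. Qed.

Lemma tr_padmx p q (M : 'M[R]_t) : (padmx p q M)^T = padmx q p M^T.
Proof. by rewrite /padmx !trmx_mul !tr_pid_mx mulmxA. Qed.

Variables (s : nat) (SB : 'M[R]_t).
Hypothesis ts : (t <= s)%N.
Hypothesis SBu : SB \in unitmx.

Lemma gsvd_Lambda1_inv :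
  gsvd_Lambda1 s SB *m (padmx s s (invmx SB) + copid_mx t) = 1%:M.
Proof.
rewrite /gsvd_Lambda1 mulmxDl (mulmxDr (padmx _ _ _)) (mulmxDr (copid_mx t)).
rewrite padmx_mul// padmx_copid// copid_padmx//.
rewrite mulmxV// addr0 add0r copid_mx_id// /padmx mulmx1 pid_mx_id//.
by rewrite /copid_mx addrC subrK.
Qed.

Lemma gsvd_Lambda1_unit : gsvd_Lambda1 s SB \in unitmx.
Proof. by have /mulmx1_unit[] := gsvd_Lambda1_inv. Qed.

Lemma invmx_gsvd_Lambda1 :
  invmx (gsvd_Lambda1 s SB) = padmx s s (invmx SB) + copid_mx t.
Proof.
by rewrite -[RHS](mulKmx gsvd_Lambda1_unit) gsvd_Lambda1_inv mulmx1.
Qed.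

(** The identity block of $\Lambda_1^{-1}$ meets zero columns. Used twice, this leads from the block
    of $S_A$ to those of $S_AS_B^{-1}$ and $S_AS_B^{-2}$. *)
Lemma padmx_invmx_Lambda1 p (M : 'M[R]_t) :
  padmx p s M *m invmx (gsvd_Lambda1 s SB) = padmx p s (M *m invmx SB).
Proof.
by rewrite invmx_gsvd_Lambda1 mulmxDr padmx_mul// padmx_copid// addr0.
Qed.

Lemma tr_invmx_gsvd_Lambda1 : SB^T = SB ->
  (invmx (gsvd_Lambda1 s SB))^T = invmx (gsvd_Lambda1 s SB).
Proof.
move=> SBT; rewrite trmx_inv /gsvd_Lambda1 linearD /= tr_padmx SBT.
by rewrite /copid_mx linearB /= trmx1 tr_pid_mx.
Qed.

End PaddedMatrix.

(** * Identities for $Q$ and $W$ derived from the GSVD *)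

Lemma diag_mx_unit (R : realType) (t : nat) (be : 'rV[R]_t) :
  (forall i, 0 < be 0 i) -> diag_mx be \in unitmx.
Proof.
move=> be0; rewrite unitmxE det_diag unitfE; apply/prodf_neq0 => i _.
by rewrite gt_eqF.
Qed.

Section GSVD.
Variables (R : realType) (m n s p q t : nat).
Variables (em : (p + q)%N = m) (en : (p + s)%N = n).
Variables (A : 'M[R]_(m, n)) (B : 'M[R]_(s, n)).
Variables (U : 'M[R]_m) (V : 'M[R]_s) (X : 'M[R]_n) (al be : 'rV[R]_t).
Hypothesis ts : (t <= s)%N.
Hypothesis gsvdAB : is_gsvd em en A B U V X al be.

Let X1 := lcols en X.
Let X2 := rcols en X.
Let U1 := lcols em U.
Let U2 := rcols em U.
Let L1 := gsvd_Lambda1 s (diag_mx be).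
Let iL1 := invmx L1.
Let S := padmx q s (diag_mx al).

Let SBu : diag_mx be \in unitmx.
Proof. by case: gsvdAB => _ [_ _ ab]; apply: diag_mx_unit => i; case: (ab i). Qed.

Let L1u : L1 \in unitmx.
Proof. exact: gsvd_Lambda1_unit. Qed.

(** These are $AX=U\Sigma$ and $BX=V\Lambda$ read by column blocks. *)
Lemma gsvd_blocks :
  [/\ A *m X1 = U1, A *m X2 = U2 *m S, B *m X1 = 0 & B *m X2 = V *m L1].
Proof.
rewrite /X1 /X2 /U1 /U2 /L1 /S; move: gsvdAB => [[_ _ Xu] [-> -> _]].
move: Xu; rewrite /lcols /rcols /gsvd_Sigma /gsvd_Lambda.
(* Eliminating the dimension equalities turns the casts into identities. *)
case: _ / em U => U'; case: _ / en X => X' Xu'; rewrite !castmx_id.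
set S0 := block_mx _ _ _ _; set L0 := row_mx _ _.
have XE : row_mx (lsubmx X') (rsubmx X') = X' by exact: hsubmxK.
have AX : U' *m S0 *m invmx X' *m row_mx (lsubmx X') (rsubmx X') = U' *m S0.
  by rewrite XE mulmxKV.
have BX : V *m L0 *m invmx X' *m row_mx (lsubmx X') (rsubmx X') = V *m L0.
  by rewrite XE mulmxKV.
move: AX; rewrite mul_mx_row -[U' in X in _ = X]hsubmxK mul_row_block.
rewrite !mulmx0 mulmx1 add0r addr0 => /eq_row_mx[-> ->].
by move: BX; rewrite !mul_mx_row mulmx0 => /eq_row_mx[-> ->].
Qed.

Lemma gsvd_orthogonal : [/\ U1^T *m U1 = 1%:M, U1^T *m U2 = 0 & V *m V^T = 1%:M].
Proof.
rewrite /U1 /U2; move: gsvdAB => [[UU VV _] _].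
suff [-> ->] : U1^T *m U1 = 1%:M /\ U1^T *m U2 = 0 by rewrite mulmx1C.
move: UU; rewrite /U1 /U2 /lcols /rcols; case: _ / em U => U'; rewrite castmx_id.
rewrite -{1 2}[U']hsubmxK tr_row_mx mul_col_row scalar_mx_block.
by move=> /eq_block_mx[-> -> _ _].
Qed.

Let W := X2 *m iL1 *m V^T.
Let Q := X1 *m X1^T.

Lemma gsvd_QB : Q *m B^T = 0.
Proof.
by have [_ _ BX1 _] := gsvd_blocks; rewrite -mulmxA -trmx_mul BX1 trmx0 mulmx0.
Qed.

Lemma gsvd_BW : B *m W = 1%:M.
Proof.
have [_ _ _ BX2] := gsvd_blocks; have [_ _ VV] := gsvd_orthogonal.
by rewrite !mulmxA BX2 -(mulmxA V) mulmxV// mulmx1.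
Qed.

(** Both sides agree on the columns of $X_1$ and of $X_2$, which together form a basis because $X$
    is invertible. *)
Lemma gsvd_QAWB : Q *m A^T *m A + W *m B = 1%:M.
Proof.
have [AX1 AX2 BX1 BX2] := gsvd_blocks; have [U11 U12 VV] := gsvd_orthogonal.
have VV' := mulmx1C VV.
have QA : Q *m A^T = X1 *m U1^T by rewrite -mulmxA -trmx_mul AX1.
have e1 : (Q *m A^T *m A + W *m B) *m X1 = X1.
  by rewrite QA mulmxDl -!mulmxA AX1 BX1 !mulmx0 addr0 U11 mulmx1.
have e2 : (Q *m A^T *m A + W *m B) *m X2 = X2.
  rewrite QA mulmxDl -!mulmxA AX2 BX2 (mulmxA U1^T) U12 mul0mx mulmx0 add0r.
  by rewrite (mulmxA V^T) VV' mul1mx mulVmx// mulmx1.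
move: e1 e2; move: (_ + _) => M; rewrite /X1 /X2 /lcols /rcols.
have : X \in unitmx by case: gsvdAB => [[]].
case: _ / en X M => X' M Xu'; rewrite castmx_id => e1 e2.
rewrite -[M](mulmxK Xu') -[X' in M *m X']hsubmxK mul_mx_row e1 e2 hsubmxK.
exact: mulmxV.
Qed.

End GSVD.

(** * The Gram matrix in terms of the GSVD *)

Section GSVDGram.
Variables (R : realType) (m n s p q t k : nat).
Variables (em : (p + q)%N = m) (en : (p + s)%N = n).
Variables (A : 'M[R]_(m, n)) (B : 'M[R]_(s, n)) (b : 'cV[R]_m).
Variables (U : 'M[R]_m) (V : 'M[R]_s) (X : 'M[R]_n) (al be : 'rV[R]_t).
Hypothesis ts : (t <= s)%N.
Hypothesis gsvdAB : is_gsvd em en A B U V X al be.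
Variables (l : 'cV[R]_s) (x : 'cV[R]_n) (L : 'M[R]_(n, k)) (aA aB ab ad : R).
Hypothesis Al : A^T *m (b - A *m x) = B^T *m l.

Lemma lse_gram_gsvd :
  let r := b - A *m x in
  let SA := diag_mx al in
  let SB := diag_mx be in
  let X1 := lcols en X in
  let X2 := rcols en X in
  let U2 := rcols em U in
  let N1 := padmx q s (SA *m invmx SB) in
  let N2 := padmx q s (SA *m invmx SB *m invmx SB) in
  let iL1 := invmx (gsvd_Lambda1 s SB) in
  let S1 := (normF x ^+ 2 / aA ^+ 2 + 1 / ab ^+ 2)%:M : 'M[R]_p in
  let S2 := (normF x ^+ 2 / aB ^+ 2 + 1 / ad ^+ 2) *: (iL1 *m iL1) in
  let Q1 := X1 *m X1^T in
  lse_gram A b Q1 (X2 *m iL1 *m V^T) l x L aA aB ab ad =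
    (normF r ^+ 2 / aA ^+ 2 + 1 / aB ^+ 2 * normF (r^T *m U2 *m N1) ^+ 2)
       *: (L^T *m (Q1 *m Q1) *m L)
    + L^T *m (X1 *m S1 *m X1^T + X2 *m S2 *m X2^T) *m L
    + (1 / aB ^+ 2) *: (L^T *m X1 *m X1^T *m x *m r^T *m U2 *m N2 *m X2^T *m L)
    + (1 / aB ^+ 2)
       *: (L^T *m X2 *m N2^T *m U2^T *m r *m x^T *m X1 *m X1^T *m L).
Proof.
move=> r SA SB X1 X2 U2 N1 N2 iL1 S1 S2 Q1; set W := X2 *m iL1 *m V^T.
have SBu : SB \in unitmx.
  by case: gsvdAB => _ [_ _ ab0]; apply: diag_mx_unit => i; case: (ab0 i).
have [_ AX2 _ _] := gsvd_blocks gsvdAB.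
have [_ _ VV] := gsvd_orthogonal gsvdAB.
have {}VV := mulmx1C VV.
have BW : B *m W = 1%:M := gsvd_BW ts gsvdAB.
have iL1T : iL1^T = iL1 by apply: tr_invmx_gsvd_Lambda1; rewrite tr_diag_mx.
have N1E : padmx q s SA *m iL1 = N1 by exact: padmx_invmx_Lambda1.
have N2E : N1 *m iL1 = N2 by exact: padmx_invmx_Lambda1.
move: (padmx q s SA) AX2 N1E => S AX2 N1E.
clearbody N1 N2 iL1.
have AW : A *m W = U2 *m N1 *m V^T by rewrite !mulmxA AX2 -N1E !mulmxA.
(* $l=(BW)^Tl=W^TA^Tr=(AW)^Tr$, and $AW=U_2N_1V^T$. *)
have lE : l = V *m (N1^T *m (U2^T *m r)).
  rewrite -[LHS]mul1mx -trmx1 -BW trmx_mul -mulmxA -Al mulmxA -trmx_mul AW.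
  by rewrite !trmx_mul trmxK -!mulmxA.
have Wl : W *m l = X2 *m N2^T *m U2^T *m r.
  by rewrite lE -N2E trmx_mul iL1T /W -!mulmxA (mulmxA V^T) VV mul1mx.
have nl : normF l ^+ 2 = normF (r^T *m U2 *m N1) ^+ 2.
  rewrite !normF_sqr lE frob_mull (mulmxA V^T) VV mul1mx.
  by rewrite -[r^T *m U2 *m N1]trmxK frob_trl !trmx_mul !trmxK.
have WW : W *m W^T = X2 *m (iL1 *m iL1) *m X2^T.
  by rewrite /W !trmx_mul trmxK iL1T -!mulmxA (mulmxA V^T) VV mul1mx.
have Q1S : X1 *m S1 *m X1^T = (normF x ^+ 2 / aA ^+ 2 + 1 / ab ^+ 2) *: Q1.
  by rewrite mul_mx_scalar -scalemxAl.
have WWS : X2 *m S2 *m X2^T = (normF x ^+ 2 / aB ^+ 2 + 1 / ad ^+ 2) *: (W *m W^T).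
  by rewrite WW -scalemxAr -scalemxAl.
have cross : L^T *m X1 *m X1^T *m x *m r^T *m U2 *m N2 *m X2^T *m L =
    L^T *m (Q1 *m x *m (W *m l)^T) *m L.
  by rewrite Wl !trmx_mul !trmxK !mulmxA.
have cross_tr : L^T *m X2 *m N2^T *m U2^T *m r *m x^T *m X1 *m X1^T *m L =
    L^T *m (W *m l *m (Q1 *m x)^T) *m L.
  by rewrite Wl !trmx_mul !trmxK !mulmxA.
rewrite /lse_gram -/r nl Q1S WWS cross cross_tr !div1r.
clearbody Q1; move: (Q1 *m Q1) (W *m W^T) (Q1 *m x *m _) (W *m l *m _) => M1 M2 M3 M4.
by rewrite scalerDr !mulmxDr !mulmxDl -!scalemxAr -!scalemxAl !addrA
  [aB ^- 2 * normF _ ^+ 2]mulrC.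
Qed.

End GSVDGram.

(** * The partial condition number formula *)

Unset Implicit Arguments.

Theorem mainTheorem4 (R : realType) (m n s k : nat)
  (nms : (n <= m + s)%N) (sn : (s <= n)%N) (kn : (k <= n)%N)
  (A : 'M[R]_(m, n)) (B : 'M[R]_(s, n)) (b : 'cV[R]_m) (d : 'cV[R]_s)
  (rankB : \rank B = s)
  (nullAB : forall v : 'cV[R]_n, A *m v = 0 -> B *m v = 0 -> v = 0)
  (L : 'M[R]_(n, k)) (aA aB ab ad : R)
  (aA0 : 0 < aA) (aB0 : 0 < aB) (ab0 : 0 < ab) (ad0 : 0 < ad)
  (x : 'cV[R]_n) (xsol : is_lse_solution A B b d x)
  (U : 'M[R]_m) (V : 'M[R]_s) (X : 'M[R]_n)
  (al be : 'rV[R]_(\rank A + s - n))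
  (gsvdAB : is_gsvd (dim_rows nms sn) (subnK sn) A B U V X al be) :
  let r := b - A *m x in
  let SA := diag_mx al in
  let SB := diag_mx be in
  let X1 := lcols (subnK sn) X in
  let X2 := rcols (subnK sn) X in
  let U2 := rcols (dim_rows nms sn) U in
  let N1 := padmx (m + s - n) s (SA *m invmx SB) in
  let N2 := padmx (m + s - n) s (SA *m invmx SB *m invmx SB) in
  let iL1 := invmx (gsvd_Lambda1 s SB) in
  let S1 := (normF x ^+ 2 / aA ^+ 2 + 1 / ab ^+ 2)%:M : 'M[R]_(n - s) in
  let S2 := (normF x ^+ 2 / aB ^+ 2 + 1 / ad ^+ 2) *: (iL1 *m iL1) in
  let Q1 := X1 *m X1^T in
  let C :=
    (normF r ^+ 2 / aA ^+ 2 + 1 / aB ^+ 2 * normF (r^T *m U2 *m N1) ^+ 2)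
       *: (L^T *m (Q1 *m Q1) *m L)
    + L^T *m (X1 *m S1 *m X1^T + X2 *m S2 *m X2^T) *m L
    + (1 / aB ^+ 2) *: (L^T *m X1 *m X1^T *m x *m r^T *m U2 *m N2 *m X2^T *m L)
    + (1 / aB ^+ 2)
       *: (L^T *m X2 *m N2^T *m U2^T *m r *m x^T *m X1 *m X1^T *m L) in
  let D : lse_data R m n s := (A, B, b, d) in
  let ratios := cond_ratios L aA aB ab ad D in
  let kappa := kappaLSE L aA aB ab ad D in
  [/\ differentiable (lse_map L : lse_data R m n s -> _) D,
      ratios !=set0 -> ratios kappa /\ ubound ratios kappa
    & kappa = Num.sqrt (norm2 C)].
Proof.
move=> r SA SB X1 X2 U2 N1 N2 iL1 S1 S2 Q1 C D ratios kappa.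
(* The bound $t\le s$ follows from $\mathrm{rank}(A)\le n$ and holds for truncated subtraction as
   well. *)
have ts : (\rank A + s - n <= s)%N by rewrite leq_subLR leq_add2r rank_leq_col.
have QB := gsvd_QB gsvdAB.
have BW := gsvd_BW ts gsvdAB.
have QAWB := gsvd_QAWB ts gsvdAB.
have Qsym : Q1^T = Q1 by rewrite trmx_mul trmxK.
have [l Al] := lse_solution_kkt QAWB BW xsol.
rewrite /C -(lse_gram_gsvd ts gsvdAB L aA aB ab ad Al).
by have [Bx _] := xsol; exact: lse_condition_number.
Qed.
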